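(* Let $G$ be a finite graph containing an induced copy of the two-edge path $P=(s,t,v)$ (with $s,v$ the endpoints and $t$ the middle vertex). If $G$ has no induced cycle of length $5$, or if every vertex of $G$ has degree at most $3$, then $G$ contains an avoidable copy of the two-rooted graph $(P,s,t)$.
   Context: All graphs are finite, simple and undirected. A two-rooted graph is a triple $(H,s,t)$ where $H$ is a graph and $s,t\in V(H)$. A copy of a two-rooted graph $(\hat H,\hat s,\hat t)$ in a graph $G$ is a two-rooted graph $(H,s,t)$ such that $H$ is an induced subgraph of $G$ and some isomorphism $\hat H\to H$ maps $\hat s\mapsto s$, $\hat t\mapsto t$. An extension of a copy $(H,s,t)$ in $G$ is a two-rooted graph $(H',s',t')$ with $H'$ an induced subgraph of $G$, $V(H')=V(H)\cup\{s',t'\}$, $s'\neq t'$, $s',t'\notin V(H)$, $H'-\{s',t'\}=H$, and $s$ (resp. $t$) the unique neighbour of $s'$ (resp. $t'$) in $H'$. The extension is closable if there is an induced $s',t'$-path in $G$ all of whose internal vertices lie outside $N_G[V(H)]$. A copy is avoidable if all its extensions in $G$ are closable. *)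

(* Defs.v *)
From mathcomp Require Import all_boot.

Set Implicit Arguments.
Unset Strict Implicit.
Unset Printing Implicit Defensive.

Record sgraph : Type := SGraph {
  vertex :> finType;
  adj : rel vertex;
  adj_sym : symmetric adj;
  adj_irr : irreflexive adj }.

Record two_rooted : Type := TwoRooted {
  tr_graph :> sgraph;
  tr_s : tr_graph;
  tr_t : tr_graph }.

Definition degree (G : sgraph) (x : G) : nat := #|[set y : G | adj x y]|.

(* N_G[A] *)
Definition closed_nbhd (G : sgraph) (A : {set G}) : {set G} :=
  A :|: [set y : G | [exists x in A, adj x y]].

(* [f] is an isomorphism from [H] onto the subgraph of [G] induced by its
   image. *)
Definition induced_emb (H G : sgraph) (f : H -> G) : Prop :=
  injective f /\ forall x y : H, adj (f x) (f y) = adj x y.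

Definition contains_induced (H G : sgraph) : Prop :=
  exists f : H -> G, induced_emb f.

(* An induced subgraph of [G] is determined by its vertex set, so a copy
   (H, s, t) in [G] is given by A = V(H) and its two roots. *)
Definition is_copy (H : two_rooted) (G : sgraph) (A : {set G}) (s t : G)
    : Prop :=
  exists f : H -> G,
    [/\ induced_emb f, f @: [set: H] = A, f (tr_s H) = s & f (tr_t H) = t].

(* V(H') is A :|: [set s'; t'], and H' - {s', t'} = H holds automatically since
   both are induced subgraphs of [G]. *)
Definition is_extension (G : sgraph) (A : {set G}) (s t s' t' : G) : Prop :=
  [/\ s' != t',
      s' \notin A,
      t' \notin A,
      forall x, x \in A :|: [set s'; t'] -> adj s' x = (x == s)
    & forall x, x \in A :|: [set s'; t'] -> adj t' x = (x == t)].

(* The vertex sequence x :: p is an induced path of [G] from x to y. *)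
Definition is_induced_path (G : sgraph) (x y : G) (p : seq G) : Prop :=
  [/\ uniq (x :: p), last x p = y
    & forall i j, i < size (x :: p) -> j < size (x :: p) ->
        adj (nth x (x :: p) i) (nth x (x :: p) j)
        = (i.+1 == j) || (j.+1 == i)].

Definition closable (G : sgraph) (A : {set G}) (s' t' : G) : Prop :=
  exists p : seq G, is_induced_path s' t' p /\
    forall v, v \in s' :: p -> v != s' -> v != t' -> v \notin closed_nbhd A.

Definition avoidable (G : sgraph) (A : {set G}) (s t : G) : Prop :=
  forall s' t' : G, is_extension A s t s' t' -> closable A s' t'.

Definition path_adj (n : nat) : rel 'I_n :=
  fun i j => (i.+1 == j :> nat) || (j.+1 == i :> nat).

Lemma path_adj_sym n : symmetric (@path_adj n).
Proof. by move=> i j; rewrite /path_adj orbC. Qed.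

Lemma path_adj_irr n : irreflexive (@path_adj n).
Proof. by move=> i; rewrite /path_adj orbb gtn_eqF. Qed.

(* The path on n vertices. *)
Definition path_graph (n : nat) : sgraph :=
  SGraph (@path_adj_sym n) (@path_adj_irr n).

(* The conjunct i != j only matters for n = 1, where the successor of 0
   modulo n is 0 itself. *)
Definition cycle_adj (n : nat) : rel 'I_n :=
  fun i j => (i != j) && ((i.+1 %% n == j) || (j.+1 %% n == i)).

Lemma cycle_adj_sym n : symmetric (@cycle_adj n).
Proof. by move=> i j; rewrite /cycle_adj eq_sym orbC. Qed.

Lemma cycle_adj_irr n : irreflexive (@cycle_adj n).
Proof. by move=> i; rewrite /cycle_adj eqxx. Qed.

(* The cycle of length n, for n >= 3. *)
Definition cycle_graph (n : nat) : sgraph :=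
  SGraph (@cycle_adj_sym n) (@cycle_adj_irr n).

(* The two-edge path s - t - v rooted at its endpoint s and its middle t. *)
Definition rooted_P3 : two_rooted :=
  @TwoRooted (path_graph 3) (inord 0 : 'I_3) (inord 1 : 'I_3).

(* Main.v *)
Require Import Defs.
From mathcomp Require Import all_boot.
From Stdlib Require Import Classical.

Set Implicit Arguments.
Unset Strict Implicit.
Unset Printing Implicit Defensive.

(* Induction on the vertex set S. Let K be a maximal connected subset of S such
   that R = S \ N[K] still contains an induced P3; by maximality every vertex
   w of N(K) \ K has a neighbour on each induced P3 of R. (If there is no
   such K, no induced P3 has an extension at all.) An induced P3 (s, t, v) of
   R that is avoidable in R can only fail to be avoidable in S through an
   extension (s', w) with s' in R and w in N(K). If some P3 of R has no
   candidate s' in R, it is avoidable. Otherwise (s', s, t) extends to s'' -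
   s' - s - t, so w is adjacent to s'', and non-closability makes s''
   adjacent to v: the vertices s, t, v, s'', s' induce a C5. In the subcubic
   case, counting the edges leaving this C5 yields a vertex of degree 2 on
   it, the middle of a P3 without extensions. *)

(** * Connectivity inside a vertex set and shortest paths *)

Definition adj_in (G : sgraph) (U : {set G}) : rel G :=
  fun x y => [&& adj x y, x \in U & y \in U].

Lemma adj_in_sub (G : sgraph) (U W : {set G}) (x y : G) :
  U \subset W -> connect (adj_in U) x y -> connect (adj_in W) x y.
Proof.
move=> /subsetP sUW; apply: connect_sub => a b /and3P[ab aU bU].
by apply: connect1; rewrite /adj_in ab !sUW.
Qed.

Lemma adj_in_sym (G : sgraph) (U : {set G}) : connect_sym (adj_in U).
Proof.
by apply: sym_connect_sym => x y; rewrite /adj_in adj_sym [(y \in U) && _]andbC.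
Qed.

(** A shortest walk is induced, since any chord would give a shorter one. *)
Lemma connect_induced_path (G : sgraph) (U : {set G}) (x y : G) :
  x \in U -> connect (adj_in U) x y ->
  exists p, is_induced_path x y p /\ {subset x :: p <= U}.
Proof.
move=> xU /connectP[p0 p0P p0y].
(* Walks are quantified as tuples so that the property of [n] is boolean and [ex_minnP] can pick a
   least length. *)
have ex : exists n,
    [exists p : n.-tuple G, path (adj_in U) x p && (last x p == y)].
  exists (size p0); apply/existsP; exists (in_tuple p0).
  by rewrite p0P -p0y eqxx.
case: (ex_minnP ex) => n /existsP[p1 /andP[p1P /eqP p1y]] nmin.
have [p [pP py] [up pn]] : exists2 p, path (adj_in U) x p /\ last x p = y
    & uniq (x :: p) /\ size p <= n.
  case/shortenP: p1P p1y => p pP up sp py; exists p => //; split=> //.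
  by rewrite -(size_tuple p1); apply: uniq_leq_size sp; case/andP: up.
have shortest q : path (adj_in U) x q -> last x q = y -> size p <= size q.
  move=> qP qy; apply: leq_trans pn _; apply: nmin; apply/existsP.
  by exists (in_tuple q); rewrite qP qy eqxx.
have pU : {subset x :: p <= U}.
  move=> z; rewrite inE => /predU1P[-> //|].
  elim: p x pP {p0P p0y ex nmin p1 p1P p1y xU py shortest pn up} => //= a p IH x.
  move=> /andP[/and3P[_ _ aU] pP].
  by rewrite inE => /predU1P[-> //|]; exact: IH pP.
have chord i j : i.+1 < j -> j < size (x :: p) ->
    ~~ adj (nth x (x :: p) i) (nth x (x :: p) j).
  move=> ij jp; apply/negP => aij.
  have ip : i <= size p by rewrite -ltnS (ltn_trans _ jp) // ltnW.
  have lasti : last x (take i p) = nth x (x :: p) i.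
    rewrite (last_nth x) size_take_min (minn_idPl ip).
    by rewrite -[x :: take i p]/(take i.+1 (x :: p)) nth_take.
  have pPi : path (adj_in U) x (take i p) by rewrite take_path.
  case: j jp ij aij => // j jp; rewrite ltnS => ij aij.
  have dropj := drop_nth x (jp : j < size p).
  (* The shortcut follows the walk to index [i], takes the chord and resumes at the chord's other
     end. That end, formerly index [j] of [x :: p], is now index [j.+1] there, that is, index [j] of
     [p]. *)
  have := shortest (take i p ++ drop j p).
  rewrite cat_path last_cat lasti dropj /=.
  move: pP py; rewrite -{1 2}(cat_take_drop j p) cat_path last_cat dropj /=.
  move=> /and3P[_ _ pjP] pjy.
  have eij : adj_in U (nth x (x :: p) i) (nth x p j).
    apply/and3P; split; [exact: aij | exact/pU/mem_nth |].
    exact/pU/(@mem_nth _ x (x :: p) j.+1).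
  rewrite pPi pjP eij.
  move=> /(_ isT pjy); rewrite size_cat /= size_drop size_take_min (minn_idPl ip).
  rewrite subnSK // addnC -leq_subLR subKn; last exact: ltnW.
  by rewrite leqNgt ij.
have step i : i < size p -> adj (nth x (x :: p) i) (nth x (x :: p) i.+1).
  by move=> ip; have /and3P[] := pathP x pP i ip.
exists p; split=> //; split=> // i j ip jp.
have [ij|ji|->] := ltngtP i j; last first.
- by rewrite adj_irr gtn_eqF.
- rewrite adj_sym [i.+1 == j]gtn_eqF; last exact: ltnW.
  have [jE|nij] := eqVneq j.+1 i.
    by rewrite -jE step // -ltnS jE.
  by apply/negbTE/chord => //; rewrite ltn_neqAle nij.
- rewrite [j.+1 == i]gtn_eqF ?orbF; last exact: ltnW.
  have [jE|nij] := eqVneq i.+1 j.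
    by rewrite -jE step // -ltnS jE.
  by apply/negbTE/chord => //; rewrite ltn_neqAle nij.
Qed.

(** * Degree bounds and induced 5-cycles *)

Lemma degree_leq3 (G : sgraph) (x : G) (s : seq G) :
  degree x <= 3 -> uniq s -> all (adj x) s -> size s <= 3.
Proof.
move=> dx us /allP sx; apply: leq_trans dx; rewrite /degree cardE.
by apply: uniq_leq_size => // y /sx xy; rewrite mem_enum inE.
Qed.

(** No distinctness has to be assumed: distinct vertices of the 5-cycle have distinct
    neighbourhoods, so a map that preserves adjacency and non-adjacency is injective. *)
Lemma C5_contained (G : sgraph) (c0 c1 c2 c3 c4 : G) :
  adj c0 c1 -> adj c1 c2 -> adj c2 c3 -> adj c3 c4 -> adj c4 c0 ->
  ~~ adj c0 c2 -> ~~ adj c0 c3 -> ~~ adj c1 c3 -> ~~ adj c1 c4 ->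
  ~~ adj c2 c4 -> contains_induced (cycle_graph 5) G.
Proof.
move=> a01 a12 a23 a34 a40 /negbTE n02 /negbTE n03 /negbTE n13 /negbTE n14.
move=> /negbTE n24.
pose f (i : 'I_5) := nth c0 [:: c0; c1; c2; c3; c4] i.
have fE (i j : 'I_5) : adj (f i) (f j) = cycle_adj i j.
  case: i => [[|[|[|[|[|i]]]]] // Hi]; case: j => [[|[|[|[|[|j]]]]] // Hj];
  rewrite /f /cycle_adj -val_eqE /= ?adj_irr //;
  by rewrite ?(a01, a12, a23, a34, a40, n02, n03, n13, n14, n24) //
     adj_sym ?(a01, a12, a23, a34, a40, n02, n03, n13, n14, n24).
exists f; split=> // i j eqf.
have eqc k : cycle_adj i k = cycle_adj j k by rewrite -!fE eqf.
have := (eqc (@Ordinal 5 0 isT), eqc (@Ordinal 5 1 isT), eqc (@Ordinal 5 2 isT),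
         eqc (@Ordinal 5 3 isT), eqc (@Ordinal 5 4 isT)).
clear; rewrite /cycle_adj -!val_eqE /= => E; apply/val_inj; move: E.
by case: i => [[|[|[|[|[|i]]]]] // Hi];
   case: j => [[|[|[|[|[|j]]]]] // Hj] /= [[[[]]]].
Qed.

(** * Induced P3s, extensions and domination within a vertex set *)

Definition is_P3 (G : sgraph) (S : {set G}) (s t v : G) : bool :=
  [&& [&& s \in S, t \in S & v \in S], adj s t, adj t v, ~~ adj s v & s != v].

Definition has_P3 (G : sgraph) (S : {set G}) : bool :=
  [exists s, exists t, exists v, is_P3 S s t v].

Definition sees (G : sgraph) (w s t v : G) : bool :=
  [|| adj w s, adj w t | adj w v].

Definition rest (G : sgraph) (S K : {set G}) : {set G} := S :\: closed_nbhd K.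

(** When (s, t, v) is an induced P3, every other disequality required of an extension follows from
    these adjacencies; only [t' != v] has to be stated. *)
Definition extends (G : sgraph) (s t v s' t' : G) : bool :=
  [&& adj s' s && adj t' t, ~~ adj s' t && ~~ adj s' v,
      ~~ adj t' s && ~~ adj t' v, ~~ adj s' t' & t' != v].

(** Connectivity is enough to close an extension: a shortest path in this set is induced, and its
    internal vertices avoid the closed neighbourhood of the P3. *)
Definition linked (G : sgraph) (S : {set G}) (s t v s' t' : G) : bool :=
  connect (adj_in (s' |: (t' |: rest S [set s; t; v]))) s' t'.

(* Avoidability of (s, t, v) in the subgraph induced by S, so that the induction
   stays inside a single graph. *)
Definition avoidable_in (G : sgraph) (S : {set G}) (s t v : G) : Prop :=
  forall s' t', s' \in S -> t' \in S -> extends s t v s' t' ->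
  linked S s t v s' t'.

Definition connected_in (G : sgraph) (K : {set G}) : bool :=
  [forall x in K, forall y in K, connect (adj_in K) x y].

(** The three conditions on [w] describe N(K) minus K inside S. This is the property that maximality
    of K provides. *)
Definition dominated (G : sgraph) (S K : {set G}) : Prop :=
  forall w x y z, w \in S -> w \notin rest S K -> w \notin K ->
  is_P3 (rest S K) x y z -> sees w x y z.

Lemma restP (G : sgraph) (S K : {set G}) (x : G) :
  reflect [/\ x \in S, x \notin K & forall k, k \in K -> ~~ adj k x]
          (x \in rest S K).
Proof.
rewrite !inE negb_or; apply: (iffP andP).
  case=> /andP[xK nx] xS; split=> // k kK; apply: contra nx => kx.
  by apply/existsP; exists k; rewrite kK.
case=> xS xK nx; split=> //; rewrite xK /=; apply/existsP => -[k /andP[kK kx]].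
by move: (nx k kK); rewrite kx.
Qed.

Lemma rest_subset (G : sgraph) (S K : {set G}) : rest S K \subset S.
Proof. exact: subsetDl. Qed.

Lemma rest_neighbor (G : sgraph) (S K : {set G}) (w : G) :
  w \in S -> w \notin rest S K -> w \notin K -> exists2 k, k \in K & adj k w.
Proof.
move=> wS wR wK; suff /existsP[k /andP[kK kw]] : [exists k in K, adj k w].
  by exists k.
apply: contraNT wR => /existsPn nk; apply/restP; split=> // k kK.
by have := nk k; rewrite kK.
Qed.

Lemma rest_adj (G : sgraph) (S K : {set G}) (x y : G) :
  x \in rest S K -> y \in S -> adj x y -> y \notin K.
Proof.
case/restP=> _ _ nx _ xy; apply/negP => /nx; by rewrite adj_sym xy.
Qed.

(** * Maximal connected sets leaving a P3 *)

Lemma connected_in1 (G : sgraph) (u : G) : connected_in [set u].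
Proof.
by apply/forall_inP => x /set1P->; apply/forall_inP => y /set1P->; exact: connect0.
Qed.

Lemma connected_inU1 (G : sgraph) (K : {set G}) (k w : G) :
  connected_in K -> k \in K -> adj k w -> connected_in (w |: K).
Proof.
move=> /forall_inP cK kK kw.
have toK x : x \in w |: K -> connect (adj_in (w |: K)) k x.
  case/setU1P => [->|xK].
    by apply: connect1; rewrite /adj_in kw !inE kK eqxx orbT.
  apply: (adj_in_sub (subsetU1 w K)).
  by have /forall_inP := cK k kK; apply.
apply/forall_inP => x xK; apply/forall_inP => y yK.
by apply: (connect_trans (y := k)); rewrite ?toK // adj_in_sym toK.
Qed.

(** If some [w] in N(K) minus K saw no vertex of an induced P3 of R, that P3 would survive the
    addition of [w] to K, which stays connected, against maximality. *)
Lemma maximal_connected (G : sgraph) (S : {set G}) (u : G) :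
  u \in S -> has_P3 (rest S [set u]) ->
  exists K : {set G},
    [/\ K \subset S, K != set0, connected_in K, has_P3 (rest S K)
      & dominated S K].
Proof.
move=> uS hu.
pose good (K : {set G}) :=
  [&& K \subset S, K != set0, connected_in K & has_P3 (rest S K)].
have : good [set u].
  by rewrite /good sub1set uS connected_in1 hu andbT -card_gt0 cards1.
case/maxset_exists => K /maxsetP[/and4P[KS K0 cK hK] Kmax] _.
exists K; split=> // w x y z wS wR wK P; apply: contraT => nw.
have [k kK kw] := rest_neighbor wS wR wK.
suff good_wK : good (w |: K).
  by rewrite -(Kmax _ good_wK (subsetU1 w K)) setU11 in wK.
rewrite /good subUset sub1set wS KS (connected_inU1 cK kK kw).
rewrite -card_gt0 cardsU1 wK /=.
apply/existsP; exists x; apply/existsP; exists y; apply/existsP; exists z.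
move: nw P; rewrite /is_P3 !negb_or => /and3P[wx wy wz].
case/andP=> /and3P[xR yR zR] ->; rewrite andbT.
have sub a : a \in rest S K -> ~~ adj w a -> a \in rest S (w |: K).
  move=> aR wa; case/restP: (aR) => aS aK na; apply/restP; split=> //.
    rewrite !inE negb_or aK andbT; apply: contraNneq wR => <-; exact: aR.
  by move=> b /setU1P[->|/na].
by rewrite !sub.
Qed.

(* Extensions with s' outside R = rest S K need no hypothesis: if t' is outside
   R too, s' and t' are joined through K; if t' is in R, the path (t', t, v) is
   not seen by s'. *)
Lemma avoidable_in_rest (G : sgraph) (S K : {set G}) (s t v : G) :
  K \subset S -> connected_in K -> dominated S K -> is_P3 (rest S K) s t v ->
  (forall s' t', s' \in rest S K -> t' \in S -> extends s t v s' t' ->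
     linked S s t v s' t') ->
  avoidable_in S s t v.
Proof.
move=> /subsetP KS cK dom P IH s' t' s'S t'S ext.
have [/IH->//|s'R] := boolP (s' \in rest S K).
case/and5P: (P) => /and3P[sR tR vR] st tv sv s_v.
case/and5P: (ext) => /andP[s's t't] /andP[s't s'v] /andP[t's t'v] s't' t'_v.
have s'K : s' \notin K by apply: rest_adj sR s'S _; rewrite adj_sym.
have t'K : t' \notin K by apply: rest_adj tR t'S _; rewrite adj_sym.
have [t'R|t'R] := boolP (t' \in rest S K).
  have : sees s' t' t v.
    by apply: dom => //; rewrite /is_P3 t'R tR vR t't tv t'v.
  by rewrite /sees (negbTE s't) (negbTE s'v) (negbTE s't').
have [k kK ks'] := rest_neighbor s'S s'R s'K.
have [l lK lt'] := rest_neighbor t'S t'R t'K.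
(* The vertices s, t, v lie in R and so have no neighbour in K; all of K may therefore serve as
   interior of a closing path. *)
have far x : x \in K -> x \in s' |: (t' |: rest S [set s; t; v]).
  move=> xK; rewrite !(in_setU1 x); apply/orP; right; apply/orP; right.
  apply/restP; split; first exact: KS.
    by rewrite !inE -orbA !negb_or; apply/and3P; split;
       apply: contraTneq xK => ->;
       [case/restP: sR | case/restP: tR | case/restP: vR].
  move=> y; rewrite !inE -orbA adj_sym.
  by case/or3P=> /eqP->; [case/restP: sR | case/restP: tR | case/restP: vR];
     move=> _ _; apply.
apply: (connect_trans (y := k)).
  by apply: connect1; rewrite /adj_in adj_sym ks' (far k kK) setU11.
apply: (connect_trans (y := l)).
  have /forall_inP/(_ k kK)/forall_inP/(_ l lK) := cK.
  by apply: adj_in_sub; apply/subsetP.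
by apply: connect1; rewrite /adj_in lt' (far l lK) !inE eqxx orbT.
Qed.

(** * The 5-cycle forced by an unclosable extension, and its subcubic refutation *)

Lemma linked_sub (G : sgraph) (S W : {set G}) (s t v s' t' : G) :
  S \subset W -> linked S s t v s' t' -> linked W s t v s' t'.
Proof. by move=> SW; apply: adj_in_sub; rewrite !setUS // setSD. Qed.

Lemma linked_two_steps (G : sgraph) (S : {set G}) (s t v s' t' x : G) :
  x \in rest S [set s; t; v] -> adj s' x -> adj x t' -> linked S s t v s' t'.
Proof.
move=> xR s'x xt'; apply: (connect_trans (y := x)); apply: connect1.
  by rewrite /adj_in s'x setU11 !in_setU xR !orbT.
by rewrite /adj_in xt' !in_setU xR !in_set1 eqxx !orbT.
Qed.

(** Vertices told apart by an adjacency or a membership are proved distinct by substituting the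
    equality, which spares most distinctness hypotheses. *)
Ltac distinct :=
  let E := fresh in
  apply/eqP => E; subst; exfalso;
  match goal with
  | H : is_true (adj ?x ?x) |- _ => by rewrite adj_irr in H
  | H : is_true (adj ?x ?y), H' : is_true (~~ adj ?x ?y) |- _ =>
      by rewrite H in H'
  | H : is_true (adj ?x ?y), H' : is_true (~~ adj ?y ?x) |- _ =>
      by rewrite adj_sym H in H'
  | H : is_true (?x \in ?A), H' : is_true (?x \notin ?A) |- _ =>
      by rewrite H in H'
  | H : is_true (?x != ?x) |- _ => by rewrite eqxx in H
  end.

Ltac adjacency := first [done | by rewrite adj_sym | distinct].

Lemma nonadj_saturated (G : sgraph) (y p q r x : G) :
  degree y <= 3 -> adj y p -> adj y q -> adj y r ->
  p != q -> p != r -> q != r -> x != p -> x != q -> x != r -> ~~ adj y x.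
Proof.
move=> dy yp yq yr pq pr qr xp xq xr; apply/negP => yx.
suff : size [:: x; p; q; r] <= 3 by [].
apply: degree_leq3 dy _ _; last by rewrite /= yx yp yq yr.
by rewrite /= !inE !negb_or xp xq xr pq pr qr.
Qed.

Lemma is_P3_sub (G : sgraph) (S W : {set G}) (s t v : G) :
  S \subset W -> is_P3 S s t v -> is_P3 W s t v.
Proof.
by move=> /subsetP SW /and5P[/and3P[sS tS vS] *]; apply/and5P; split; rewrite ?SW.
Qed.

Lemma dominated_P3 (G : sgraph) (S K : {set G}) (w x y z : G) :
  dominated S K -> w \in S -> w \notin rest S K -> w \notin K ->
  x \in rest S K -> y \in rest S K -> z \in rest S K ->
  adj x y -> adj y z -> ~~ adj x z -> x != z ->
  ~~ adj w x -> ~~ adj w y -> adj w z.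
Proof.
move=> dom wS wR wK xR yR zR xy yz nxz x_z nwx nwy.
have : sees w x y z by apply: dom => //; apply/and5P; rewrite xR yR zR.
by rewrite /sees (negbTE nwx) (negbTE nwy).
Qed.

(* Extending (a, s, t) to b - a - s - t within R forces w to see b, and b to see
   v, since otherwise a - b - w would link a to w. *)
Lemma outside_neighbor_C5 (G : sgraph) (S K : {set G}) (s t v a w : G) :
  dominated S K ->
  (forall x y z, is_P3 (rest S K) x y z -> exists2 x', x' \in rest S K &
     [/\ adj x' x, ~~ adj x' y & ~~ adj x' z]) ->
  is_P3 (rest S K) s t v -> a \in rest S K -> w \in S -> w \notin rest S K ->
  extends s t v a w -> ~~ linked S s t v a w ->
  exists2 b, b \in rest S K &
    [/\ adj a b, adj w b, adj b v, ~~ adj b s & ~~ adj b t].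
Proof.
move=> dom extR /and5P[/and3P[sR tR vR] st tv sv s_v] aR wS wR.
move=> /and5P[/andP[a_s wt] /andP[nat nav] /andP[nws nwv] naw w_v] nlink.
have wK : w \notin K by apply: rest_adj tR wS _; rewrite adj_sym.
have [|c cR [ca ncs nct]] := extR a s t.
  by apply/and5P; rewrite aR sR tR; split; adjacency.
have nwa : ~~ adj w a by rewrite adj_sym.
have wc : adj w c.
  by apply: (dominated_P3 dom wS wR wK sR aR cR); adjacency.
exists c => //; split=> //; first by rewrite adj_sym.
apply: contraNT nlink => ncv; apply: (linked_two_steps (x := c)).
- apply/restP; split; first by case/restP: cR.
    by rewrite !inE !negb_or -andbA; apply/and3P; split; distinct.
  by move=> y; rewrite !inE -orbA adj_sym => /or3P[]/eqP->.
- by rewrite adj_sym.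
- by rewrite adj_sym.
Qed.

(* The third neighbour d of a would be outside R (else w does not see (d, a, s)),
   but then d does not see (s, t, v), all three being saturated. *)
Lemma saturated_C5 (G : sgraph) (S K : {set G}) (s t v a b w c k : G) :
  (forall x : G, degree x <= 3) -> dominated S K ->
  (forall x y z, is_P3 S x y z ->
     exists2 d, d \in S & [/\ adj y d, d != x & d != z]) ->
  s \in rest S K -> t \in rest S K -> v \in rest S K ->
  a \in rest S K -> b \in rest S K ->
  adj s t -> adj t v -> adj a s -> adj a b -> adj b v ->
  ~~ adj s v -> ~~ adj a t -> ~~ adj a v -> ~~ adj b s -> ~~ adj b t ->
  w \in S -> w \notin rest S K -> w \notin K ->
  adj w t -> adj w b -> ~~ adj w s -> ~~ adj w a -> ~~ adj w v ->
  (forall x, x \in rest S K -> x != t -> x != b -> ~~ adj w x) ->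
  c \in S -> c \notin rest S K -> c \notin K ->
  k \in K -> k \notin rest S K -> adj c k -> adj c v -> adj c s -> False.
Proof.
move=> deg dom third sR tR vR aR bR st tv a_s ab bv nsv nat nav nbs nbt.
move=> wS wR wK wt wb nws nwa nwv wonly cS cR cK kK kR ck cv cs.
have [ts vt sa ba vb] : [/\ adj t s, adj v t, adj s a, adj b a & adj v b].
  by split; rewrite adj_sym.
have [tw bw vc sc] : [/\ adj t w, adj b w, adj v c & adj s c].
  by split; rewrite adj_sym.
have s_v : s != v by distinct.
have s_k : s != k by distinct.
have v_k : v != k by distinct.
have nca : ~~ adj c a.
  by apply: (nonadj_saturated (deg c) cs cv ck); adjacency.
have [|d dS [ad d_s d_b]] := third s a b.
  apply: is_P3_sub (rest_subset S K) _; apply/and5P; rewrite sR aR bR.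
  by split; adjacency.
have d_c : d != c by distinct.
have nsd : ~~ adj s d.
  by apply: (nonadj_saturated (deg s) sa st sc); adjacency.
have [dR|dR] := boolP (d \in rest S K).
  have : ~~ adj w d by apply: wonly => //; distinct.
  apply/negP; rewrite negbK.
  by apply: (dominated_P3 dom wS wR wK sR aR dR); adjacency.
have dK : d \notin K by apply: rest_adj aR dS ad.
have ntd : ~~ adj t d.
  by apply: (nonadj_saturated (deg t) ts tv tw); adjacency.
have nvd : ~~ adj v d.
  by apply: (nonadj_saturated (deg v) vt vb vc); adjacency.
suff : adj d v by rewrite adj_sym (negbTE nvd).
by apply: (dominated_P3 dom dS dR dK sR tR vR); adjacency.
Qed.

(** The vertices s, t, v, b, a form the 5-cycle, with t and b saturated by [w]. The third neighbour
    [c] of v cannot lie in R, and outside R it must see s or a. The reflection fixing v swaps s with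
    a and t with b, so both cases are instances of [saturated_C5]. *)
Lemma subcubic_no_C5 (G : sgraph) (S K : {set G}) (s t v a b w : G) :
  (forall x : G, degree x <= 3) -> dominated S K ->
  (forall x y z, is_P3 S x y z ->
     exists2 d, d \in S & [/\ adj y d, d != x & d != z]) ->
  (forall x y z, is_P3 (rest S K) x y z -> exists2 x', x' \in rest S K &
     [/\ adj x' x, ~~ adj x' y & ~~ adj x' z]) ->
  s \in rest S K -> t \in rest S K -> v \in rest S K ->
  a \in rest S K -> b \in rest S K ->
  adj s t -> adj t v -> adj a s -> adj a b -> adj b v ->
  ~~ adj s v -> ~~ adj a t -> ~~ adj a v -> ~~ adj b s -> ~~ adj b t ->
  w \in S -> w \notin rest S K -> w \notin K ->
  adj w t -> adj w b -> ~~ adj w s -> ~~ adj w a -> ~~ adj w v -> False.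
Proof.
move=> deg dom third extR sR tR vR aR bR st tv a_s ab bv nsv nat nav nbs nbt.
move=> wS wR wK wt wb nws nwa nwv.
have KR k : k \in K -> k \notin rest S K.
  by move=> kK; apply/negP => /restP[_]; rewrite kK.
have [ts vt sa ba vb] : [/\ adj t s, adj v t, adj s a, adj b a & adj v b].
  by split; rewrite adj_sym.
have [tw bw] : adj t w /\ adj b w by split; rewrite adj_sym.
have t_b : t != b by distinct.
(* The third neighbour of [w] is spent on K. *)
have wonly x : x \in rest S K -> x != t -> x != b -> ~~ adj w x.
  move=> xR x_t x_b; have [k kK kw] := rest_neighbor wS wR wK.
  have nkR := KR k kK.
  have wk : adj w k by rewrite adj_sym.
  by apply: (nonadj_saturated (deg w) wt wb wk); adjacency.
have [|c cS [vc c_t c_b]] := third t v b.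
  apply: is_P3_sub (rest_subset S K) _; apply/and5P; rewrite tR vR bR.
  by split; adjacency.
have ntc : ~~ adj t c.
  by apply: (nonadj_saturated (deg t) ts tv tw); adjacency.
have nbc : ~~ adj b c.
  by apply: (nonadj_saturated (deg b) ba bv bw); adjacency.
have [cR|cR] := boolP (c \in rest S K).
  have nwc := wonly c cR c_t c_b.
  (* As [w] misses v and c, domination of (v, c, z) makes it see z, a neighbour in R other than t
     and b. *)
  have [|z zR [zc nzv nzt]] := extR c v t.
    by apply/and5P; rewrite cR vR tR; split; adjacency.
  have z_t : z != t by distinct.
  have z_b : z != b by distinct.
  have : ~~ adj w z by exact: wonly.
  apply/negP; rewrite negbK.
  by apply: (dominated_P3 dom wS wR wK vR cR zR); adjacency.
have cK : c \notin K by apply: rest_adj vR cS vc.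
have [k kK kc] := rest_neighbor cS cR cK.
have nkR := KR k kK.
have [cs|ncs] := boolP (adj c s).
  by apply: (saturated_C5 deg dom third (s := s) (t := t) (v := v) (a := a)
    (b := b) (w := w) (c := c) (k := k)) => //; rewrite adj_sym.
(* Domination of (t, s, a): [c] misses t and s. *)
have ca : adj c a.
  by apply: (dominated_P3 dom cS cR cK tR sR aR); adjacency.
by apply: (saturated_C5 deg dom third (s := a) (t := b) (v := v) (a := s)
    (b := t) (w := w) (c := c) (k := k)) => //;
  first [by rewrite adj_sym | by move=> x xR x_b x_t; apply: wonly].
Qed.

(** * Induction on the vertex set *)

(** Both alternatives of [hG] concern the whole of G, so they serve unchanged for every subset S met
    in the induction on its size. *)
Lemma avoidable_P3_in (G : sgraph) :
  ~ contains_induced (cycle_graph 5) G \/ (forall x : G, degree x <= 3) ->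
  forall S : {set G}, has_P3 S ->
  exists s t v, is_P3 S s t v /\ avoidable_in S s t v.
Proof.
move=> hG S; have [n] := ubnP #|S|; elim: n S => // n IHn S.
rewrite ltnS => Sn hS; apply: NNPP => none.
have noavo s t v : is_P3 S s t v -> avoidable_in S s t v -> False.
  by move=> P avo; apply: none; exists s, t, v.
have third x y z : is_P3 S x y z ->
    exists2 d, d \in S & [/\ adj y d, d != x & d != z].
  move=> P; apply: NNPP => nd; apply: (noavo x y z P) => s' t' s'S t'S.
  (* A path whose middle vertex has no third neighbour has no extension. *)
  case/and5P=> /andP[s'x t'y] _ _ ns't' t'_z; exfalso; apply: nd.
  by exists t' => //; split; adjacency.
have [[u uS hu]|nou] :
    (exists2 u, u \in S & has_P3 (rest S [set u])) \/
    (forall u, u \in S -> has_P3 (rest S [set u]) -> False).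
- have [|nu] := classic (exists2 u, u \in S & has_P3 (rest S [set u])).
    by left.
  by right=> u uS hu; apply: nu; exists u.
- have [K [KS K0 cK hK dom]] := maximal_connected uS hu.
  have RS := rest_subset S K.
  have Rn : #|rest S K| < n.
    apply: leq_trans Sn; apply: proper_card; rewrite properE RS /=.
    have /set0Pn[k kK] := K0; apply/subsetPn; exists k.
      exact: (subsetP KS).
    by apply/negP => /restP[_]; rewrite kK.
  (* A P3 of R with no candidate for s' in R would be avoidable in S, because only extensions with
     s' in R remain to be closed. *)
  have extR x y z : is_P3 (rest S K) x y z ->
      exists2 x', x' \in rest S K &
        [/\ adj x' x, ~~ adj x' y & ~~ adj x' z].
    move=> P; apply: NNPP => nx; apply: (noavo x y z (is_P3_sub RS P)).
    apply: (avoidable_in_rest KS cK dom P) => s' t' s'R t'S.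
    case/and5P=> /andP[s'x t'y] /andP[ns'y ns'z] _ _ _; exfalso.
    by apply: nx; exists s'.
  have [s [t [v [P avoR]]]] := IHn _ Rn hK.
  apply: (noavo s t v (is_P3_sub RS P)).
  apply: (avoidable_in_rest KS cK dom P) => a w aR wS ext.
  apply: contraT => nlink; exfalso.
  (* With [w] in R, avoidability within R already links a to w, and a link in R is one in S. *)
  have [wR|wR] := boolP (w \in rest S K).
    by have := avoR a w aR wR ext; move/(linked_sub RS); apply/negP.
  have [b bR [ab wb bv nbs nbt]] :=
    outside_neighbor_C5 dom extR P aR wS wR ext nlink.
  case/and5P: P => /and3P[sR tR vR] st tv nsv s_v.
  case/and5P: ext => /andP[a_s wt] /andP[nat nav] /andP[nws nwv] naw w_v.
  have wK : w \notin K by apply: rest_adj tR wS _; rewrite adj_sym.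
  case: hG => [noC5|deg].
    by apply: noC5; apply: (C5_contained (c0 := s) (c1 := t) (c2 := v) (c3 := b)
      (c4 := a)); adjacency.
  by apply: (subcubic_no_C5 deg dom third extR sR tR vR aR bR st tv a_s ab bv
    nsv nat nav nbs nbt wS wR wK wt wb nws _ nwv); adjacency.
(* An extension (s', t') would leave the induced P3 (t', t, v) outside the closed neighbourhood of
   s', contrary to [nou]; so avoidability is vacuous. *)
- have /existsP[s /existsP[t /existsP[v P]]] := hS.
  apply: (noavo s t v P) => s' t' s'S t'S ext; exfalso; apply: (nou s' s'S).
  case/and5P: P => /and3P[sR tR vR] st tv nsv s_v.
  case/and5P: ext => /andP[s's t't] /andP[ns't ns'v] /andP[nt's nt'v] ns't' t'_v.
  apply/existsP; exists t'; apply/existsP; exists t; apply/existsP; exists v.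
  have far x : x \in S -> ~~ adj s' x -> x != s' -> x \in rest S [set s'].
    move=> xS ns'x x_s'; apply/restP; split=> //; first by rewrite inE.
    by move=> k /set1P->.
  apply/and5P; split=> //; apply/and3P; split; apply: far => //; distinct.
Qed.

(** * From triples of vertices back to copies in [G] *)

Theorem theorem1p10 (G : sgraph)
  (hP : contains_induced (path_graph 3) G)
  (hG : ~ contains_induced (cycle_graph 5) G
        \/ forall x : G, degree x <= 3) :
  exists (A : {set G}) (s t : G),
    is_copy rooted_P3 A s t /\ avoidable A s t.
Proof.
have hS : has_P3 [set: G].
  case: hP => f [finj fE].
  apply/existsP; exists (f (inord 0)); apply/existsP; exists (f (inord 1)).
  apply/existsP; exists (f (inord 2)).
  rewrite /is_P3 !inE !fE (inj_eq finj) /= /path_adj -val_eqE /=.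
  by rewrite !inordK.
have [s [t [v [P avo]]]] := avoidable_P3_in hG hS.
case/and5P: P => _ st tv nsv s_v.
exists [set s; t; v], s, t; split.
  pose f (i : path_graph 3) := nth s [:: s; t; v] (i : 'I_3).
  have s_t : s != t by distinct.
  have t_v : t != v by distinct.
  exists f; split; rewrite /f /= ?inordK //.
    split.
      move=> i j /eqP; rewrite nth_uniq ?ltn_ord //.
        by move/eqP/val_inj.
      by rewrite /= !inE negb_or s_t s_v t_v.
    case=> [[|[|[|i]]] // Hi]; case=> [[|[|[|j]]] // Hj] /=;
    rewrite /path_adj /= ?adj_irr ?st ?tv ?(negbTE nsv) //;
    by rewrite adj_sym ?st ?tv ?(negbTE nsv).
  apply/setP => x; rewrite !inE; apply/imsetP/idP.
    case=> [[[|[|[|i]]] // Hi]] _ -> /=; rewrite eqxx ?orbT //.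
  rewrite -orbA; case/or3P=> /eqP->.
  - by exists (@Ordinal 3 0 isT).
  - by exists (@Ordinal 3 1 isT).
  - by exists (@Ordinal 3 2 isT).
move=> s' t' [s't' s'A t'A s'adj t'adj].
have ext : extends s t v s' t'.
  have t'_s : t' != s by apply: contraNneq t'A => ->; rewrite !inE eqxx ?orbT.
  have t'_v : t' != v by apply: contraNneq t'A => ->; rewrite !inE eqxx ?orbT.
  have t_s : t != s by distinct.
  have v_t : v != t by distinct.
  have t'in : t' \in [set s; t; v] :|: [set s'; t'] by rewrite !inE eqxx !orbT.
  have in3 x : x \in [:: s; t; v] -> x \in [set s; t; v] :|: [set s'; t'].
    by rewrite !inE -!orbA => /or3P[]->; rewrite ?orbT.
  rewrite /extends.
  rewrite !(s'adj s, s'adj t, s'adj v, s'adj t', t'adj s, t'adj t, t'adj v)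
    ?t'in ?in3 ?inE ?eqxx ?orbT //.
  by rewrite t_s t'_s t'_v v_t [v == s]eq_sym s_v [s == t]eq_sym t_s.
(* For S the full vertex set, [rest] is the complement of the closed neighbourhood of the copy, so
   an induced path in the linking set closes the extension. *)
have [p [pP pU]] := connect_induced_path (setU11 _ _)
  (avo s' t' (in_setT _) (in_setT _) ext).
exists p; split=> // x xp x_s' x_t'.
have := pU x xp; rewrite !(in_setU1 x) (negbTE x_s') (negbTE x_t') /=.
by rewrite inE => /andP[].
Qed.
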